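(* Let $n\ge 3$. If a sequence $(a_1,\ldots,a_n;b_1,\ldots,b_n;s)$ of positive integers, with $a_1=\ldots=a_n=a$ and $b_1=\ldots=b_n=b$, is an essential Betti sequence, then 1) $s=n(b-a)$; 2) $na<(n-1)b\le (n+1)a$; moreover, when $n$ is even, $(n-1)b<(n+1)a$.
   Context: $k$ is a field. A sequence $(a_1,\ldots,a_n;b_1,\ldots,b_n;s)$ is called an essential Betti sequence if there is a homogeneous ideal $I$ of height at least $2$ in a standard graded polynomial ring $R=k[x_1,\ldots,x_r]$ for some $r\ge 3$ (the number of variables is not prescribed) such that $R/I$ has a graded minimal free resolution $$0\to R(-s)\to\bigoplus_{j=1}^n R(-b_j)\to\bigoplus_{i=1}^n R(-a_i)\to R\to R/I\to 0.$$ *)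

(* Defs.v *)
From HB Require Import structures.
From mathcomp Require Import all_boot all_order all_algebra.
From mathcomp Require Import ring_quotient mpoly.

Set Implicit Arguments.
Unset Strict Implicit.
Unset Printing Implicit Defensive.

Import GRing.Theory.
Local Open Scope ring_scope.

Section Height.

Variable R : comNzRingType.
Implicit Types P Q I : {pred R}.

(* [idealr_closed] already includes that the ideal is proper. *)
Definition prime_ideal P : Prop := idealr_closed P /\ prime_idealr_closed P.

Definition strict_sub P Q : Prop :=
  {subset P <= Q} /\ ~ {subset Q <= P}.

(* P_0 < P_1 < ... < P_l = P, a chain of primes of length l ending at P. *)
Definition prime_chain_to P (l : nat) : Prop :=
  exists C : nat -> {pred R},
    [/\ forall i, (i <= l)%N -> prime_ideal (C i),
        forall i, (i < l)%N -> strict_sub (C i) (C i.+1)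
      & C l =i P].

(* The height of a prime is the supremum of the lengths of such chains, and
   ht I is the infimum of the heights of the primes containing I; these are
   the inequalities ht P >= h and ht I >= h. *)
Definition prime_height_ge (h : nat) P : Prop :=
  exists2 l, (h <= l)%N & prime_chain_to P l.

Definition height_ge (h : nat) I : Prop :=
  forall P, prime_ideal P -> {subset I <= P} -> prime_height_ge h P.

End Height.

Section GradedResolution.

Variables (k : fieldType) (r : nat).
Local Notation R := {mpoly k[r]}.

Definition homogeneous_ideal (I : {pred R}) : Prop :=
  idealr_closed I /\
  forall f d, f \in I -> pihomog mdeg d f \in I.

(* A matrix acts on column vectors.  M is a degree-0 map
   (+)_j R(- q_j) -> (+)_i R(- p_i) exactly when M i j is homogeneous of
   degree q_j - p_i, hence 0 if that degree is negative. *)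
Definition graded_map (m n : nat) (p : 'I_m -> nat) (q : 'I_n -> nat)
    (M : 'M[R]_(m, n)) : Prop :=
  forall i j,
    if (p i <= q j)%N then M i j \is (q j - p i).-homog else M i j == 0.

(* M maps R^n into mm R^m, with mm = (x_1, ..., x_r) the ideal of the
   polynomials without constant term. *)
Definition minimal_map (m n : nat) (M : 'M[R]_(m, n)) : Prop :=
  forall i j, (M i j)@_0%MM = 0.

(* 0 -> R(-s) -> (+)_j R(-b_j) -> (+)_i R(-a_i) -> R -> R/I -> 0, with
   R -> R/I the canonical projection, so that exactness at R says that the
   image of d1 is I. *)
Definition graded_minimal_resolution (n : nat) (I : {pred R})
    (a b : 'I_n -> nat) (s : nat)
    (d1 : 'M[R]_(1, n)) (d2 : 'M[R]_(n, n)) (d3 : 'M[R]_(n, 1)) : Prop :=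
  [/\ [/\ graded_map (fun=> 0%N) a d1, graded_map a b d2
        & graded_map b (fun=> s) d3],
      [/\ minimal_map d1, minimal_map d2 & minimal_map d3]
    & [/\ forall f : R, f \in I <-> exists v : 'cV[R]_n, f%:M = d1 *m v,
          forall v : 'cV[R]_n, d1 *m v = 0 <-> exists w : 'cV[R]_n, v = d2 *m w,
          forall w : 'cV[R]_n, d2 *m w = 0 <-> exists u : 'cV[R]_1, w = d3 *m u
        & forall u : 'cV[R]_1, d3 *m u = 0 -> u = 0]].

End GradedResolution.

Definition essential_Betti_sequence (k : fieldType) (n : nat)
    (a b : 'I_n -> nat) (s : nat) : Prop :=
  exists (r : nat) (I : {pred {mpoly k[r]}}),
    [/\ (3 <= r)%N, homogeneous_ideal I, height_ge 2 I
      & exists d1 d2 d3, graded_minimal_resolution I a b s d1 d2 d3].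

(* Main.v *)
Require Import Defs.
From mathcomp Require Import all_boot all_order all_algebra.
From mathcomp Require Import mpoly perm boolp zify.

(** Let [f], [D] and [g] be the three matrices of the resolution: a row, a square
    matrix and a column.

    The degree formula [s = n (b - a)] is the comparison of degrees in an identity
    [\adj D = c (g f)] with [c] a nonzero constant.  Exactness gives
    [\adj D = g rho] for a row [rho], and multiplication by [f 0 i] is homotopic to
    zero on the resolution, by a homotopy [W i] with
    [D (W i) = f 0 i - e_i f]; this makes [rho] proportional to [f] over the
    fraction field, and a determinant computation with [W i] shows that
    [rho 0 i] divides [f 0 i ^ (n - 1)].  The polynomial ring is factorial, and in
    a factorial ring an ideal of height at least two lies in no ideal generated by
    a prime element.  So the entries of [f] have no common prime factor; hence
    [rho = c f] with [c] in the ring, and since a prime factor of [c] would divide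
    all powers [f 0 i ^ (n - 1)], [c] is a unit
    (lemmas [factorial_mpoly], [height_ge2_coprime], [adjugate_middle_map]).

    Minimality of [g] gives [b < s], which by the degree formula is
    [n a < (n - 1) b].

    The upper bound [(n - 1) b <= (n + 1) a] is the inequality [s <= a + b], and
    the two become equalities together.  The homotopies [W i] are the products of
    two generators in a multiplication on the resolution; they can be chosen
    alternating.  The Leibniz rule then defines the product of a generator and a
    relation, which is a square matrix [Q] with entries of degree [a + b - s], and
    [f^T = Q g].  So [Q] is nonzero, and [s <= a + b].  If [s = a + b], then [Q] is
    a constant matrix, and it is invertible because the generators are linearly
    independent over the field.  The matrix [D^T Q] is alternating, in any
    characteristic, because the [W i] are; as its kernel has rank one, its size [n]
    is odd ([constant_pairing], [pairing_alternating], [perfect_pairing_odd]). *)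

Set Implicit Arguments.
Unset Strict Implicit.
Unset Printing Implicit Defensive.

Import GRing.Theory.

Local Open Scope ring_scope.

(** * Prime elements and factorial domains *)

Section PrimeElements.

Variable R : idomainType.
Implicit Types (x y z p : R).

Definition divides x y : Prop := exists z, y = x * z.

Definition prime_elt p : Prop :=
  [/\ p != 0, p \isn't a GRing.unit
    & forall x y, divides p (x * y) -> divides p x \/ divides p y].

(** Products of prime elements up to a unit, in the form that allows induction on
    the factorization. *)
Inductive prime_product : R -> Prop :=
| PrimeProductUnit u : u \is a GRing.unit -> prime_product u
| PrimeProductCons p x :
    prime_elt p -> prime_product x -> prime_product (p * x).

Lemma divides_mulr x y z : divides x y -> divides x (y * z).
Proof. by case=> t ->; exists (t * z); rewrite mulrA. Qed.

Lemma divides_mull x y z : divides x y -> divides x (z * y).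
Proof. by rewrite mulrC; apply: divides_mulr. Qed.

Lemma dividesD x y z : divides x y -> divides x z -> divides x (y + z).
Proof. by move=> [t ->] [u ->]; exists (t + u); rewrite mulrDr. Qed.

Lemma dividesN x y : divides x y -> divides x (- y).
Proof. by case=> t ->; exists (- t); rewrite mulrN. Qed.

Lemma divides0 x : divides x 0.
Proof. by exists 0; rewrite mulr0. Qed.

Lemma divides_sum (I : Type) (r : seq I) (P : pred I) (F : I -> R) x :
  (forall i, P i -> divides x (F i)) -> divides x (\sum_(i <- r | P i) F i).
Proof.
move=> divF; elim/big_rec: _ => [|i y Pi]; first exact: divides0.
exact/dividesD/divF.
Qed.

Lemma prime_elt_divides_exp p x m :
  prime_elt p -> divides p (x ^+ m) -> divides p x.
Proof.
case=> _ p_nunit p_prime; elim: m => [|m IHm]; last first.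
  by rewrite exprS => /p_prime[|/IHm].
by case=> z; rewrite expr0 => /esym pz1; case/unitrPr: p_nunit; exists z.
Qed.

Lemma prime_productM x y :
  prime_product x -> prime_product y -> prime_product (x * y).
Proof.
elim=> [u Uu|p z p_prime _ IHz] y_prod; last first.
  by rewrite -mulrA; constructor=> //; apply: IHz.
elim: y_prod => [v Uv|p z p_prime _ IHz]; first by constructor; rewrite unitrM Uu.
by rewrite mulrCA; constructor.
Qed.

(** Each prime factor of [x] divides some [y * f j] but not the corresponding
    [f j], so it divides [y] and can be cancelled. *)
Lemma prime_product_divides (I : Type) (f g : I -> R) x y :
    (forall p, prime_elt p -> ~ forall j, divides p (f j)) ->
  prime_product x -> (forall j, x * g j = y * f j) -> divides x y.
Proof.
move=> f_coprime x_prod; elim: x_prod y => [u Uu|p z p_prime _ IHz] y xg_yf.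
  by exists (u^-1 * y); rewrite mulrA divrr // mul1r.
have [p_neq0 _ p_dvd] := p_prime.
have [y' def_y] : divides p y.
  apply: contrapT => p_ndvd_y; apply: (f_coprime p p_prime) => j.
  have: divides p (y * f j) by rewrite -xg_yf -mulrA; exists (z * g j).
  by case/p_dvd.
have [|t def_y'] := IHz y'; last by exists t; rewrite def_y def_y' mulrA.
by move=> j; apply: (mulfI p_neq0); rewrite !mulrA xg_yf def_y.
Qed.

End PrimeElements.

(** Only existence is demanded: a factorization into prime, rather than
    irreducible, elements is automatically unique. *)
Definition factorial_domain (R : idomainType) : Prop :=
  forall x : R, x != 0 -> prime_product x.

(** * Gauss's lemma *)

Section GaussLemma.

Variable A : idomainType.
Hypothesis factA : factorial_domain A.
Implicit Types (f g h : {poly A}).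

(** Over a factorial domain this says that the content is a unit. *)
Definition primitive f : Prop :=
  forall p : A, prime_elt p -> ~ divides p%:P f.

Lemma divides_polyC (c : A) f :
  divides c%:P f <-> forall i, divides c f`_i.
Proof.
split=> [[g ->] i|/choice[h def_f]]; first by exists g`_i; rewrite coefCM.
exists (\poly_(i < size f) h i); apply/polyP=> i.
rewrite coefCM coef_poly; case: ltnP => [_|le_f_i]; first exact: def_f.
by rewrite mulr0 nth_default.
Qed.

(** Modulo [p] the lowest surviving terms of two polynomials multiply to a
    surviving term of the product. *)
Lemma prime_elt_polyC (p : A) : prime_elt p -> prime_elt p%:P.
Proof.
case=> p_neq0 p_nunit p_prime; split; first by rewrite polyC_eq0.
  by rewrite poly_unitE coefC eqxx (negPf p_nunit) andbF.
have lowest f : ~ divides p%:P f ->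
    exists2 i, ~ divides p f`_i & forall j, (j < i)%N -> divides p f`_j.
  move/divides_polyC/existsNP => [i0 ndvd_i0].
  have ex_i : exists i, ~~ `[< divides p f`_i >] by exists i0; apply/asboolPn.
  case: (ex_minnP ex_i) => i /asboolPn ndvd_i min_i; exists i => // j lt_ji.
  by apply: contrapT => /asboolPn/min_i; rewrite leqNgt lt_ji.
move=> f g p_dvd_fg; have [?|/lowest[i ndvd_i dvd_lt_i]] := EM (divides p%:P f).
  by left.
have [?|/lowest[j ndvd_j dvd_lt_j]] := EM (divides p%:P g); first by right.
have := (divides_polyC _ _).1 p_dvd_fg (i + j)%N.
have lt_i_ij : (i < (i + j).+1)%N by rewrite ltnS leq_addr.
rewrite coefM (bigD1 (Ordinal lt_i_ij)) //= addKn => dvd_sum.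
suff: divides p (f`_i * g`_j) by case/p_prime.
rewrite -[_ * _](addrK (\sum_(l < (i + j).+1 | l != Ordinal lt_i_ij)
  f`_l * g`_(i + j - l))).
apply: dividesD => //; apply/dividesN/divides_sum => l ne_l.
have: (l < i)%N || (i < l)%N by rewrite -neq_ltn; apply: contra ne_l => /eqP eq_l; apply/eqP/val_inj.
case/orP=> [/dvd_lt_i|lt_il]; first exact: divides_mulr.
apply/divides_mull/dvd_lt_j; have := ltn_ord l; lia.
Qed.

(** The prime factors of [c] divide [f * h] and not [f], hence divide [h]: they can
    be cancelled one at a time. *)
Lemma primitive_dividesZ f g (c : A) :
  primitive f -> c != 0 -> divides f (c *: g) -> divides f g.
Proof.
move=> f_prim /factA c_prod; elim: c_prod g => [u Uu|p z p_prime _ IHz] g [h].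
  by move=> def_h; exists (u^-1 *: h); rewrite -scalerAr -def_h scalerA mulVr ?scale1r.
have [p_neq0 _ p_dvd] := prime_elt_polyC p_prime.
rewrite -scalerA -mul_polyC => def_h.
have [h' def_h'] : divides p%:P h.
  by case: (p_dvd f h) => [|/(f_prim p p_prime)|//]; exists (z *: g).
apply: IHz; exists h'; apply: (mulfI p_neq0).
by rewrite def_h def_h' mulrCA.
Qed.

(** Over the fraction field an irreducible polynomial is prime; primitivity
    clears the denominators of the quotient. *)
Lemma prime_elt_primitive_irreducible f :
  primitive f -> irreducible_poly f -> prime_elt f.
Proof.
move=> f_prim f_irr; have f_neq0 := irredp_neq0 f_irr; split=> //.
  by rewrite poly_unitE; case: f_irr => [/gtn_eqF ->].
have dvdpW g : f %| g -> divides f g.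
  case/Pdiv.WeakIdomain.dvdpP => -[c q] /= c_neq0 def_g.
  by apply: (primitive_dividesZ f_prim c_neq0); exists q; rewrite def_g mulrC.
move=> g h [q def_gh]; have [f_g|f_ndvd_g] := boolP (f %| g); first by left; apply: dvdpW.
right; apply: dvdpW; rewrite -(@Pdiv.Idomain.Gauss_dvdpr _ h g f).
  by rewrite def_gh; apply: dvdp_mulr.
apply/Pdiv.Idomain.coprimepP => d d_f d_g.
have [d1|d1] := eqVneq (size d) 1%N; first by rewrite -size_poly_eq1 d1.
have /(Pdiv.Idomain.eqp_dvdl g) d_f_g := f_irr.2 d d1 d_f.
by rewrite d_f_g (negPf f_ndvd_g) in d_g.
Qed.

(** The bound [c] on the constant divisors of [f] is what makes the extraction of
    the content terminate.  A prime factor of [c] is either split off from [f], or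
    divides no constant divisor of [f] and is dropped from the bound. *)
Lemma primitive_part f (c : A) : prime_product c ->
    (forall d : A, divides d%:P f -> divides d c) ->
  exists2 b : A, prime_product b & exists2 g, primitive g & f = b%:P * g.
Proof.
move=> c_prod; elim: c_prod f => [u Uu|p z p_prime z_prod IHz] f f_c.
  exists 1; first by constructor; apply: unitr1.
  exists f; last by rewrite mul1r.
  move=> q [_ q_nunit _] /f_c[t def_u]; case/negP: q_nunit.
  by move: Uu; rewrite def_u unitrM => /andP[].
have [p_neq0 _ p_dvd] := p_prime.
have [[g def_f]|p_ndvd_f] := EM (divides p%:P f).
  have [d [t def_g]|b b_prod [h h_prim def_g]] := IHz g.
    have [|w] := f_c (p * d); first by exists t; rewrite def_f def_g polyCM mulrA.
    by rewrite -mulrA => /(mulfI p_neq0) ->; exists w.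
  exists (p * b); first exact: PrimeProductCons.
  by exists h => //; rewrite def_f def_g polyCM mulrA.
apply: IHz => d d_f; have [e def_pz] := f_c d d_f.
have [[t def_d]|[t def_e]] : divides p d \/ divides p e.
- by apply: p_dvd; exists z.
- case: p_ndvd_f; case: d_f => q ->; exists (t%:P * q).
  by rewrite def_d polyCM mulrA.
by exists t; apply: (mulfI p_neq0); rewrite def_pz def_e mulrCA.
Qed.

(** The content factors in [A].  A primitive polynomial that is reducible over the
    fraction field has there a factor of smaller degree, whose primitive part is a
    factor over [A]. *)
Theorem factorial_poly : factorial_domain {poly A}.
Proof.
have factor f : f != 0 ->
    exists2 b : A, prime_product b & exists2 g, primitive g & f = b%:P * g.
  (* A constant divisor of [f] divides the leading coefficient. *)
  move=> f_neq0; apply: (@primitive_part f (lead_coef f)).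
    by apply: factA; rewrite lead_coef_eq0.
  by move=> d /divides_polyC; apply.
have polyC_prod (b : A) : prime_product b -> prime_product b%:P.
  elim=> [u Uu|p z p_prime _ IHz].
    apply: PrimeProductUnit.
    have u_neq0 : u != 0 by apply: contraTneq Uu => ->; rewrite unitr0.
    by rewrite poly_unitE coefC size_polyC u_neq0 eqxx.
  by rewrite polyCM; constructor=> //; apply: prime_elt_polyC.
have size_factor (b : A) g : b%:P * g != 0 -> size (b%:P * g) = size g.
  by rewrite mulf_eq0 polyC_eq0 negb_or => /andP[b_neq0 _]; rewrite mul_polyC size_scale.
move=> f; have [m] := ubnP (size f); elim: m f => // m IHm f.
rewrite ltnS => le_f_m f_neq0.
have [b b_prod [g g_prim def_f]] := factor f f_neq0.
have size_g : size f = size g by rewrite def_f size_factor // -def_f.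
have g_neq0 : g != 0 by apply: contraNneq f_neq0; rewrite def_f => ->; rewrite mulr0.
rewrite def_f; apply: prime_productM; first exact: polyC_prod.
have [size_g1|size_g1] := leqP (size g) 1.
  rewrite (size1_polyC size_g1) in g_prim g_neq0 *; apply: polyC_prod.
  by apply: factA; rewrite -polyC_eq0.
have [g_irr|g_red] := EM (irreducible_poly g).
  rewrite -[g]mulr1; constructor; last by constructor; apply: unitr1.
  exact: prime_elt_primitive_irreducible.
have [q [size_q q_dvd_g q_neq_g]] :
    exists q : {poly A}, [/\ size q != 1%N, q %| g & ~ q %= g].
  apply: contrapT => no_q; apply: g_red; split=> // q size_q q_g.
  by apply: contrapT => q_neq_g; apply: no_q; exists q.
have q_neq0 : q != 0.
  by apply: contraNneq g_neq0 => q0; rewrite q0 dvd0p in q_dvd_g.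
have [c c_prod [h h_prim def_q]] := factor q q_neq0.
have size_h : size q = size h by rewrite def_q size_factor // -def_q.
have h_neq0 : h != 0 by rewrite -size_poly_eq0 -size_h size_poly_eq0.
have [t def_g] : divides h g.
  case/Pdiv.WeakIdomain.dvdpP: q_dvd_g => -[d w] /= d_neq0 def_dg.
  apply: (primitive_dividesZ h_prim d_neq0).
  by exists (c%:P * w); rewrite def_dg def_q mulrCA [w * h]mulrC mulrCA.
have t_neq0 : t != 0 by apply: contraNneq g_neq0; rewrite def_g => ->; rewrite mulr0.
have size_gD := size_mul h_neq0 t_neq0.
rewrite -def_g in size_gD.
have size_h_g : (size h < size g)%N.
  rewrite -size_h ltn_neqAle (Pdiv.Idomain.dvdp_leq g_neq0 q_dvd_g) andbT.
  by apply/eqP=> eq_size; apply: q_neq_g; rewrite -Pdiv.Idomain.dvdp_size_eqp // eq_size.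
have size_h1 : (1 < size h)%N.
  by rewrite -size_h; have := size_q; rewrite -size_poly_gt0 in q_neq0; lia.
rewrite def_g; apply: prime_productM; apply: IHm => //; lia.
Qed.

End GaussLemma.

Lemma factorial_iso (R S : idomainType) (u : {rmorphism R -> S})
    (v : {rmorphism S -> R}) :
  cancel u v -> cancel v u -> factorial_domain S -> factorial_domain R.
Proof.
move=> uK vK factS x x_neq0; rewrite -[x]uK.
have: u x != 0 by apply: contraNneq x_neq0 => ux0; rewrite -[x]uK ux0 rmorph0.
move/factS; elim=> [w Uw|p z [p_neq0 p_nunit p_dvd] _ IHz].
  by constructor; apply: rmorph_unit.
rewrite rmorphM; constructor=> //; split.
- by apply: contraNneq p_neq0 => vp0; rewrite -[p]vK vp0 rmorph0.
- by apply: contraNN p_nunit => /(rmorph_unit u); rewrite vK.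
have vdvd (y : R) : divides p (u y) -> divides (v p) y.
  by case=> t def_uy; exists (v t); rewrite -rmorphM -def_uy uK.
move=> y w [t def_yw]; case: (p_dvd (u y) (u w)) => [|/vdvd|/vdvd]; try by [left|right].
by exists (u t); rewrite -rmorphM def_yw rmorphM vK.
Qed.

Section MpolyFactorial.

Variable k : fieldType.

Lemma mnmwiden_restrict n (m : 'X_{1..n.+1}) :
  (mnmwiden [multinom m (widen_ord (leqnSn n) i) | i < n]
     + U_(ord_max) *+ m ord_max)%MM = m.
Proof.
apply/mnmP=> i; rewrite mnmDE mulmnE mnm1E.
have [->|ne_i] := eqVneq i ord_max; first by rewrite mnmwiden_ordmax mul1n.
have lt_i_n : (i < n)%N by rewrite ltn_neqAle ne_i -ltnS /=.
have def_i : i = widen_ord (leqnSn n) (Ordinal lt_i_n) by apply: val_inj.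
by rewrite mul0n addn0 {1}def_i mnmwiden_widen mnmE -def_i.
Qed.

(** The inverse of [muni] substitutes the last variable for the polynomial
    variable. *)
Lemma muniK n :
  cancel (@muni n k) (horner_eval 'X_ord_max \o map_poly (@mwiden n k)).
Proof.
move=> p; rewrite muniE raddf_sum [RHS]mpolyE; apply: eq_bigr => m _.
rewrite /= /horner_eval -mul_polyC rmorphM /= map_polyC map_polyXn /=.
rewrite hornerM hornerC hornerXn mwidenZ mwidenX -scalerAl; congr (_ *: _).
by rewrite mpolyXn -mpolyXD mnmwiden_restrict.
Qed.

Lemma mpoly_of_uniK n :
  cancel (horner_eval 'X_ord_max \o map_poly (@mwiden n k)) (@muni n k).
Proof.
have muni_Xmax : muni 'X_ord_max = 'X :> {poly {mpoly k[n]}}.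
  rewrite muniE msuppX big_seq1 mcoeffX eqxx scale1r mnm1E eqxx expr1.
  rewrite (_ : [multinom _ | _ < n] = 0%MM) ?mpolyX0 ?scale1r //.
  by apply/mnmP=> i; rewrite mnmE mnm1E mnm0E eqE /= gtn_eqF.
have muni_widen (c : {mpoly k[n]}) : muni (mwiden c) = c%:P.
  rewrite [c]mpolyE (raddf_sum (@mwiden n k)) (raddf_sum (@muni n k)) raddf_sum.
  apply: eq_bigr => m _ /=.
  rewrite mwidenZ mwidenX muniZ muniE msuppX big_seq1 mcoeffX eqxx scale1r.
  rewrite mnmwiden_ordmax expr0 alg_polyC -mul_polyC -polyCM mul_mpolyC.
  by congr (_ *: 'X_[_])%:P; apply/mnmP=> i; rewrite mnmE mnmwiden_widen.
move=> f; rewrite /= /horner_eval -[f in RHS]coefK poly_def.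
rewrite horner_coef size_map_inj_poly ?mwiden0 //; last exact: inj_mwiden.
rewrite raddf_sum; apply: eq_bigr => i _ /=.
by rewrite coef_map /= rmorphM rmorphXn /= muni_Xmax muni_widen mul_polyC.
Qed.

Theorem factorial_mpoly n : factorial_domain {mpoly k[n]}.
Proof.
elim: n => [|n IHn].
  move=> p p_neq0; apply: PrimeProductUnit.
  have p_const := nvar0_mpolyC p; rewrite p_const.
  apply: rmorph_unit; rewrite unitfE; apply: contraNneq p_neq0 => p0.
  by rewrite p_const p0 mpolyC0.
exact: (factorial_iso (@muniK n) (@mpoly_of_uniK n) (factorial_poly IHn)).
Qed.

End MpolyFactorial.

(** * Height at least two *)

(** In a chain [P0 < P1 < (p)] of primes the middle one would contain a nonzero
    element without containing [p]; but a prime ideal contains a prime factor of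
    each of its nonzero elements, and a prime element of [(p)] generates [(p)]. *)
Lemma height_ge2_coprime (R : idomainType) (I : {pred R}) (p : R) :
    factorial_domain R -> height_ge 2 I -> prime_elt p ->
  ~ forall x, x \in I -> divides p x.
Proof.
move=> factR I_ht p_prime I_p; have [p_neq0 p_nunit p_dvd] := p_prime.
pose P : {pred R} := fun x => `[< divides p x >].
have inP x : x \in P <-> divides p x by split=> [/asboolP|/asboolP].
have P_prime : prime_ideal P.
  split; last first.
    by move=> x y /inP/p_dvd[] /inP ->; rewrite ?orbT.
  split; first by apply/inP/divides0.
    by apply/negP=> /inP[t /esym pt1]; case/unitrPr: p_nunit; exists t.
  by move=> a x y /inP x_p /inP y_p; apply/inP/dividesD => //; apply: divides_mull.
have [|l le2l [C [C_prime C_strict C_P]]] := I_ht P P_prime.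
  by move=> x /I_p/inP.
case: l => [//|[//|l]] in le2l C_prime C_strict C_P.
have [[C2_0 _ _] _] := C_prime l (leqW (leqnSn l)).
have [[C1_0 C1_1 C1_D] C1_dvd] := C_prime l.+1 (leqnSn l.+1).
have [_ C2_C1] := C_strict l (ltnW (ltnSn _)).
have [C1_P P_C1] := C_strict l.+1 (ltnSn _).
have C1M x a : x \in C l.+1 -> a * x \in C l.+1.
  by move=> xC; rewrite -[a * x]addr0 C1_D.
have p_C1 : p \notin C l.+1.
  apply/negP=> pC; apply: P_C1 => x; rewrite C_P => /inP[t ->].
  by rewrite mulrC C1M.
apply: C2_C1 => x xC1; have [->//|/factR x_prod] := eqVneq x 0; exfalso.
elim: x_prod xC1 => [u Uu|q y [q_neq0 q_nunit q_dvd] _ IHy].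
  by move=> /(C1M _ u^-1); rewrite mulVr // (negPf C1_1).
move/C1_dvd/orP => [qC|//].
have /C1_P := qC; rewrite C_P => /inP[t def_q].
have [[w def_p]|[w def_t]] : divides q p \/ divides q t.
- by apply: q_dvd; exists 1; rewrite mulr1.
- by case/negP: p_C1; rewrite def_p mulrC C1M.
case/unitrPr: p_nunit; exists w; apply: (mulfI q_neq0).
by rewrite mulr1 {2}def_q def_t mulrCA.
Qed.

(** * Alternating matrices *)

(** Orbits of size two cancel and fixed points contribute nothing, whatever the
    characteristic. *)
Lemma sum_involution_opp (V : zmodType) (T : finType) (s : T -> T)
    (F : T -> V) :
    involutive s -> (forall x, F (s x) = - F x) ->
    (forall x, s x = x -> F x = 0) ->
  \sum_x F x = 0.
Proof.
move=> sK F_s F_fix; pose lt (x y : T) := (enum_rank x < enum_rank y)%N.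
rewrite (bigID (fun x => lt x (s x))) /=.
have -> : \sum_(x | ~~ lt x (s x)) F x = \sum_(x | lt (s x) x) F x.
  rewrite [LHS]big_mkcond [RHS]big_mkcond; apply: eq_bigr => x _.
  rewrite /lt; case: ltngtP => //= /val_inj/enum_rank_inj/esym/F_fix //.
rewrite [X in _ + X](reindex_inj (inv_inj sK)) /=.
under [X in _ + X]eq_bigl => x do rewrite sK.
by under [X in _ + X]eq_bigr => x _ do rewrite F_s; rewrite sumrN subrr.
Qed.

Definition alternating (R : pzRingType) n (A : 'M[R]_n) : Prop :=
  A^T = - A /\ forall i, A i i = 0.

Lemma alternatingE (R : pzRingType) n (A : 'M[R]_n) i j :
  alternating A -> A i j = - A j i.
Proof. by case=> /matrixP/(_ j i); rewrite !mxE. Qed.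

Lemma alternating_congr (R : comPzRingType) m n (A : 'M[R]_m)
    (P : 'M[R]_(m, n)) :
  alternating A -> alternating (P^T *m A *m P).
Proof.
move=> altA; have [trA diagA] := altA; split.
  by rewrite !trmx_mul trmxK trA !(mulmxN, mulNmx) mulmxA.
move=> j; rewrite mxE.
under eq_bigr => l _ do rewrite mxE mulr_suml.
rewrite pair_bigA; apply: (@sum_involution_opp _ _ (fun x => (x.2, x.1))).
- by case.
- by case=> l i /=; rewrite !mxE (alternatingE l i altA) mulrN mulNr mulrAC
    [in RHS]mulrAC [P l j * _]mulrC.
- by case=> l i /= [->]; rewrite diagA mulr0 mul0r.
Qed.

(** In the Leibniz formula the terms of a permutation and of its inverse are
    opposite, and an involution of a set of odd size has a fixed point. *)
Lemma det_alternating_odd (R : comPzRingType) n (A : 'M[R]_n) :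
  odd n -> alternating A -> \det A = 0.
Proof.
move=> odd_n altA; rewrite /determinant.
apply: (@sum_involution_opp R 'S_n (fun s => s^-1%g)) => [|s|s]; first exact: invgK.
  rewrite odd_permV (reindex_inj (@perm_inj _ s)) /=.
  under eq_bigr => i _ do rewrite permK (alternatingE _ _ altA).
  by rewrite prodrN cardT size_enum_ord -[(-1) ^+ n]signr_odd odd_n mulN1r mulrN.
move=> sV; have sK : involutive s by move=> i; rewrite -{1}sV permK.
have [i s_i|no_fix] := pickP (fun i => s i == i).
  by rewrite (bigD1 i) //= (eqP s_i) altA.2 mul0r mulr0.
suff: ~~ odd n by rewrite odd_n.
pose up := [set i : 'I_n | (i < s i)%N].
rewrite -[n]card_ord -(cardsC up) -(_ : s @: up = ~: up).
  by rewrite card_imset ?addnn ?odd_double //; apply: perm_inj.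
apply/setP=> i; rewrite -[i in LHS]sK (mem_imset _ _ perm_inj) !inE sK -leqNgt.
by rewrite [in RHS]leq_eqVlt (inj_eq val_inj) no_fix.
Qed.

(** Outside row and column [i] an alternating matrix of even size is alternating
    of odd size, hence singular. *)
Lemma alternating_even_kernel (R : idomainType) n (B : 'M[R]_n) (i : 'I_n) :
    ~~ odd n -> alternating B ->
  exists x : 'cV[R]_n,
    [/\ x != 0, x i 0 = 0 & forall j, j != i -> (B *m x) j 0 = 0].
Proof.
case: n => [|n] in B i *; first by case: i.
rewrite /= negbK => odd_n altB.
have altC : alternating (row' i (col' i B)).
  by split=> [|a]; [apply/matrixP=> a b|]; rewrite !mxE ?altB.2 // (alternatingE _ _ altB).
have /eqP/det0P[v v_neq0 vC] := det_alternating_odd odd_n altC.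
exists (\col_j if unlift i j is Some a then v 0 a else 0); split.
- apply: contra_neq v_neq0 => /matrixP x0; apply/matrixP=> o a.
  by have := x0 (lift i a) 0; rewrite !mxE liftK ord1.
- by rewrite mxE unlift_none.
move=> j; case: (unliftP i j) => [a ->|->]; last by rewrite eqxx.
move=> _; rewrite mxE (bigD1_ord i) //= mxE unlift_none mulr0 add0r.
have /matrixP/(_ 0 a) := vC; rewrite !mxE => vC_a.
apply: (@oppr_inj R); rewrite oppr0 -[RHS]vC_a -sumrN; apply: eq_bigr => b _.
by rewrite !mxE liftK (alternatingE _ _ altB) mulNr opprK mulrC.
Qed.

(** * Resolutions of length three with equally many generators and relations *)

(** The exact complex [0 -> R -> R^n -> R^n -> R] with maps [g], [D] and [f], as in a
    free resolution of a cyclic module. *)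
Section LengthThree.

Variables (R : idomainType) (n : nat).
Variables (f : 'rV[R]_n) (D : 'M[R]_n) (g : 'cV[R]_n).

Hypothesis fD : f *m D = 0.
Hypothesis Dg : D *m g = 0.
Hypothesis exact1 : forall v : 'cV[R]_n, f *m v = 0 -> exists w, v = D *m w.
Hypothesis exact2 : forall w : 'cV[R]_n, D *m w = 0 -> exists u, w = g *m u.
Hypothesis g_inj : forall u : 'cV[R]_1, g *m u = 0 -> u = 0.

(** The Koszul relation [f 0 i * e_j - f 0 j * e_i] is a syzygy, so it lifts to the
    second module; the column [j] of [W i] is the lift.  Lifting only for [i < j]
    and extending by antisymmetry gives the vanishing diagonal also in
    characteristic two. *)
Lemma koszul_homotopy :
  exists W : 'I_n -> 'M[R]_n,
    [/\ forall i, D *m W i = (f 0 i)%:M - delta_mx i 0 *m f,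
        forall i j l, W i l j = - W j l i
      & forall i l, W i l i = 0].
Proof.
have /choice[w w_def] (ij : 'I_n * 'I_n) : exists w : 'cV[R]_n,
    f 0 ij.1 *: delta_mx ij.2 0 - f 0 ij.2 *: delta_mx ij.1 0 = D *m w.
  apply: exact1; case: ij => i j /=.
  rewrite mulmxBr -!scalemxAr -!colE; apply/matrixP=> a b.
  by rewrite !mxE !ord1 mulrC subrr.
exists (fun i : 'I_n => \matrix_(l, j) if (i < j)%N then w (i, j) l 0
  else if (j < i)%N then - w (j, i) l 0 else 0); split=> [i|i j l|i l].
- apply/matrixP=> m j; rewrite !mxE big_ord1 !mxE eqxx andbT.
  have dw a b : \sum_l D m l * w (a, b) l 0
      = f 0 a * (m == b)%:R - f 0 b * (m == a)%:R.
    by have /matrixP/(_ m 0) := w_def (a, b); rewrite !mxE !eqxx !andbT => ->.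
  under eq_bigr => l _ do rewrite mxE.
  case: ltngtP => [_|_|/val_inj <-].
  + by rewrite dw mulr_natr [_ * f 0 j]mulrC.
  + under eq_bigr => l _ do rewrite mulrN.
    by rewrite sumrN dw opprB mulr_natr [_ * f 0 j]mulrC.
  + by under eq_bigr => l _ do rewrite mulr0; rewrite big1 // mulr_natl subrr.
- by rewrite !mxE; case: ltngtP => // _; rewrite ?opprK ?oppr0.
- by rewrite !mxE ltnn.
Qed.

Lemma last_map_neq0 : exists j, g j 0 != 0.
Proof.
apply/existsP; rewrite -negb_forall; apply/negP=> /forallP g0.
have /matrixP/(_ 0 0)/eqP : (1%:M : 'cV[R]_1) = 0.
  apply: g_inj; rewrite mulmx1; apply/matrixP=> j o.
  by rewrite ord1 mxE; apply/eqP/g0.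
by rewrite !mxE oner_eq0.
Qed.

Lemma last_map_inj m (u : 'rV[R]_m) : g *m u = 0 -> u = 0.
Proof.
have [j g_j] := last_map_neq0 => /matrixP gu0; apply/matrixP=> o l.
rewrite !ord1; apply/eqP; move: (gu0 j l); rewrite !mxE big_ord1 => /eqP.
by rewrite mulf_eq0 (negPf g_j).
Qed.

Lemma middle_map_det0 : \det D = 0.
Proof.
have [j g_j] := last_map_neq0; have : \adj D *m (D *m g) = 0 by rewrite Dg mulmx0.
rewrite mulmxA mul_adj_mx mul_scalar_mx => /matrixP/(_ j 0)/eqP.
by rewrite !mxE mulf_eq0 (negPf g_j) orbF => /eqP.
Qed.

(** If [f] were zero, [D] would be surjective, hence invertible. *)
Lemma first_map_neq0 : exists i, f 0 i != 0.
Proof.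
apply/existsP; rewrite -negb_forall; apply/negP=> /forallP f0.
have f_eq0 : f = 0 by apply/matrixP=> o i; rewrite ord1 mxE; apply/eqP/f0.
have /choice[w w_def] (l : 'I_n) : exists w : 'cV[R]_n,
    delta_mx l 0 = D *m w.
  by apply: exact1; rewrite f_eq0 mul0mx.
have : D *m (\matrix_(m, l) w l m 0) = 1%:M.
  apply/matrixP=> m l; have /matrixP/(_ m 0) := w_def l.
  by rewrite !mxE eqxx andbT => ->; apply: eq_bigr => t _; rewrite mxE.
move/(congr1 determinant); rewrite det_mulmx middle_map_det0 mul0r det1.
by move/esym/eqP; rewrite oner_eq0.
Qed.

Lemma adjugate_factor : exists rho : 'rV[R]_n, \adj D = g *m rho.
Proof.
have /choice[u u_def] (l : 'I_n) : exists u, col l (\adj D) = g *m u.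
  by apply: exact2; rewrite colE mulmxA mul_mx_adj middle_map_det0 raddf0 mul0mx.
exists (\row_l u l 0 0); apply/matrixP=> m l.
by have /matrixP/(_ m 0) := u_def l; rewrite !mxE !big_ord1 mxE.
Qed.

(** The row [rho] is annihilated by [D], hence by [D *m W i], which is [f 0 i] minus
    a matrix of rank one with row space spanned by [f]. *)
Lemma cofactor_proportional (rho : 'rV[R]_n) i j :
  \adj D = g *m rho -> f 0 i * rho 0 j = rho 0 i * f 0 j.
Proof.
move=> def_rho; have rhoD : rho *m D = 0.
  by apply: last_map_inj; rewrite mulmxA -def_rho mul_adj_mx middle_map_det0 raddf0.
have [W [DW _ _]] := koszul_homotopy.
have : rho *m (D *m W i) = 0 by rewrite mulmxA rhoD mul0mx.
rewrite DW mulmxBr mul_mx_scalar mulmxA -colE => /matrixP/(_ 0 j).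
by rewrite !mxE big_ord1 !mxE => /eqP; rewrite subr_eq0 => /eqP.
Qed.

(** Replacing row [i] of [D] by a unit vector and column [i] of the homotopy by
    [g] makes both determinants computable: the product of the two matrices is
    [f 0 i] times the identity away from row and column [i]. *)
Lemma cofactor_divides_exp (rho : 'rV[R]_n) i :
  \adj D = g *m rho -> divides (rho 0 i) (f 0 i ^+ n.-1).
Proof.
move=> def_rho; have [j g_j] := last_map_neq0.
have [W [DW _ _]] := koszul_homotopy.
pose D' := \matrix_(l, m) if l == i then (m == j)%:R else D l m.
pose V := \matrix_(l, m) if m == i then g l 0 else W i l m.
have detD' : \det D' = g j 0 * rho 0 i.
  have /matrixP/(_ j i) := def_rho; rewrite !mxE big_ord1 => <-.
  rewrite (expand_det_row _ i) (bigD1 j) //= !mxE !eqxx mul1r big1 ?addr0.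
    rewrite /cofactor; congr (_ * \det _); apply/matrixP=> a b.
    by rewrite !mxE eq_sym (negPf (neq_lift _ _)).
  by move=> m /negPf m_j; rewrite !mxE eqxx m_j mul0r.
have detD'V : \det (D' *m V) = g j 0 * f 0 i ^+ n.-1.
  have colV l : (D' *m V) l i = if l == i then g j 0 else 0.
    rewrite mxE; have [->|l_i] := eqVneq l i.
      rewrite (bigD1 j) //= !mxE !eqxx mul1r big1 ?addr0 // => m /negPf m_j.
      by rewrite !mxE eqxx m_j mul0r.
    have /matrixP/(_ l 0) := Dg; rewrite !mxE => Dg_l; rewrite -[RHS]Dg_l.
    by apply: eq_bigr => m _; rewrite !mxE eqxx (negPf l_i).
  rewrite (expand_det_col _ i) (bigD1 i) //= colV eqxx big1 ?addr0; last first.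
    by move=> l /negPf l_i; rewrite colV l_i mul0r.
  congr (_ * _); rewrite /cofactor -signr_odd addnn odd_double mul1r.
  rewrite -det_scalar; congr (\det _); apply/matrixP=> a b.
  have lift_neq (c : 'I_n.-1) : (lift i c == i) = false.
    by rewrite eq_sym (negPf (neq_lift _ _)).
  have /matrixP/(_ (lift i a) (lift i b)) := DW i.
  rewrite !mxE big_ord1 !mxE lift_neq mul0r subr0 (inj_eq lift_inj) => <-.
  by apply: eq_bigr => m _; rewrite !mxE !lift_neq.
exists (\det V); apply: (mulfI g_j).
by rewrite -detD'V det_mulmx detD' mulrA.
Qed.

(** Up to sign the minors of [D] of size [n - 1] are the products of an entry of
    [g], an entry of [f] and a fixed fraction [c].  Coprimality of the entries of
    [f] makes [c] integral, and a prime factor of [c] would divide each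
    [f 0 i ^+ n.-1]. *)
Theorem adjugate_middle_map :
    factorial_domain R ->
    (forall p, prime_elt p -> ~ forall i, divides p (f 0 i)) ->
  exists2 c, c \is a GRing.unit & \adj D = c *: (g *m f).
Proof.
move=> factR f_coprime; have [rho def_rho] := adjugate_factor.
have [i f_i] := first_map_neq0.
have [|c def_rho_i] := @prime_product_divides R _ (f 0) (rho 0) (f 0 i) (rho 0 i)
  f_coprime (factR _ f_i).
  by move=> j; apply: cofactor_proportional.
have def_rho_j j : rho 0 j = c * f 0 j.
  apply: (mulfI f_i); rewrite (cofactor_proportional i j def_rho) def_rho_i.
  by rewrite mulrA.
exists c; last first.
  rewrite def_rho scalemxAr; congr (_ *m _); apply/matrixP=> o j.
  by rewrite ord1 def_rho_j !mxE.
have c_neq0 : c != 0.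
  apply: contraNneq (expf_neq0 n.-1 f_i) => c0.
  have [t ->] := cofactor_divides_exp i def_rho.
  by rewrite def_rho_j c0 !mul0r.
case: (factR c c_neq0) def_rho_j => // p x p_prime _ def_rho_j.
case: (f_coprime p p_prime) => j; apply: (prime_elt_divides_exp (m := n.-1) p_prime).
have [t ->] := cofactor_divides_exp j def_rho.
by rewrite def_rho_j; exists (x * f 0 j * t); rewrite !mulrA.
Qed.

(** The product of the generator [i] and the relation [l] is the entry [Q i l].  The
    Leibniz rule prescribes its image under [g], and this prescription is a cycle
    because [W i] is a homotopy. *)
Lemma leibniz_pairing (W : 'I_n -> 'M[R]_n) :
    (forall i, D *m W i = (f 0 i)%:M - delta_mx i 0 *m f) ->
  exists Q : 'M[R]_n, forall i, (f 0 i)%:M - W i *m D = g *m row i Q.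
Proof.
move=> DW; have /choice[u u_def] (il : 'I_n * 'I_n) : exists u,
    col il.2 ((f 0 il.1)%:M - W il.1 *m D) = g *m u.
  apply: exact2; case: il => i l /=.
  have DX : D *m ((f 0 i)%:M - W i *m D) = 0.
    rewrite mulmxBr mulmxA DW mulmxBl mul_mx_scalar mul_scalar_mx.
    by rewrite -mulmxA fD mulmx0 subr0 subrr.
  by rewrite colE mulmxA DX mul0mx.
exists (\matrix_(i, l) u (i, l) 0 0) => i; apply/matrixP=> m l.
have /matrixP/(_ m 0) := u_def (i, l).
by rewrite [LHS]mxE => ->; rewrite !mxE !big_ord1 !mxE.
Qed.

Section Pairing.

(** [V] and [Q] are the products in degrees (1,1) and (1,2) of a multiplication
    on the resolution; the hypothesis on [Q] is the Leibniz rule. *)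
Variables (V : 'I_n -> 'M[R]_n) (Q : 'M[R]_n).
Hypothesis V_anti : forall i j l, V i l j = - V j l i.
Hypothesis V_diag : forall i l, V i l i = 0.
Hypothesis leibniz : forall i, (f 0 i)%:M - V i *m D = g *m row i Q.

(** By the Leibniz rule [g m 0] times this matrix is [- D^T N D], where the matrix
    [N] collects the row [m] of all the [V i] and is alternating because the product
    of two generators is. *)
Lemma pairing_alternating : alternating (D^T *m Q).
Proof.
have [m g_m] := last_map_neq0; pose N := \matrix_(i, t) V i m t.
have altN : alternating N.
  by split=> [|i]; [apply/matrixP=> i t|]; rewrite !mxE.
have gB j l : g m 0 * (D^T *m Q) j l = - (D^T *m N *m D) j l.
  rewrite -mulmxA !mxE mulr_sumr -sumrN.
  have -> : \sum_i - (D^T j i * (N *m D) i l)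
      = \sum_i (D i j * (f 0 i *+ (m == l)) - D^T j i * (N *m D) i l).
    rewrite big_split /= -[LHS]add0r; congr (_ + _); symmetry.
    under eq_bigr => i _ do rewrite mulrnAr mulrC.
    have /matrixP/(_ 0 j) := fD; rewrite !mxE => fD_j.
    by rewrite sumrMnl fD_j mul0rn.
  apply: eq_bigr => i _; rewrite !mxE mulrCA -mulrBr; congr (_ * _).
  have /matrixP/(_ m l) := leibniz i; rewrite !mxE big_ord1 !mxE => <-.
  by congr (_ - _); apply: eq_bigr => t _; rewrite !mxE.
have altDND := alternating_congr D altN.
split=> [|i]; last by apply: (mulfI g_m); rewrite gB altDND.2 oppr0 mulr0.
apply/matrixP=> i j; apply: (mulfI g_m).
rewrite [X in _ * X = _]mxE [X in _ = _ * X]mxE mulrN !gB opprK.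
by rewrite (alternatingE j i altDND) opprK.
Qed.

(** Multiply the Leibniz rule by [g], which [D] annihilates, and cancel an entry of
    [g]: up to [Q] the resolution is its own dual. *)
Lemma first_map_pairing : f^T = Q *m g.
Proof.
have [j g_j] := last_map_neq0; apply/matrixP=> i o; apply: (mulfI g_j).
have /(congr1 (mulmxr g)) /= := leibniz i.
rewrite mulmxBl -[V i *m D *m g]mulmxA Dg mulmx0 subr0 mul_scalar_mx -mulmxA.
move=> /matrixP/(_ j 0); rewrite !mxE big_ord1 !ord1 mulrC => ->.
by congr (_ * _); rewrite !mxE; apply: eq_bigr => l _; rewrite mxE.
Qed.

(** [D^T *m Q] is an alternating matrix with one-dimensional kernel.  Deleting
    row and column [i], with [g i 0] nonzero, leaves an alternating matrix of odd
    size if [n] is even; a nonzero kernel vector of it, extended by zero, lies in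
    the kernel of [D] but is not a multiple of [g]. *)
Lemma perfect_pairing_odd : \det Q != 0 -> odd n.
Proof.
move=> detQ; apply: contraT => even_n; have [i g_i] := last_map_neq0.
have altB := pairing_alternating; set B := D^T *m Q in altB.
have B_def : B = - (Q^T *m D) by rewrite -[B]opprK -altB.1 trmx_mul trmxK.
have Bg : B *m g = 0 by rewrite B_def mulNmx -mulmxA Dg mulmx0 oppr0.
have kerB (x : 'cV[R]_n) : B *m x = 0 -> D *m x = 0.
  rewrite B_def mulNmx -mulmxA => /(congr1 -%R); rewrite opprK oppr0 => QDx.
  have := congr1 (mulmx (\adj Q^T)) QDx.
  rewrite mulmx0 !mulmxA mul_adj_mx det_tr -mulmxA mul_scalar_mx => /matrixP Dx0.
  apply/matrixP=> a b; apply: (mulfI detQ).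
  by have := Dx0 a b; rewrite !mxE mulr0.
have [x [x_neq0 x_i Bx]] := alternating_even_kernel i even_n altB.
have gB : g^T *m B = 0 by rewrite -[B]trmxK altB.1 -trmx_mul mulNmx Bg oppr0 trmx0.
have Bx0 : B *m x = 0.
  apply/matrixP=> a b; rewrite ord1 [RHS]mxE.
  have [->|/Bx//] := eqVneq a i; apply: (mulfI g_i); rewrite mulr0.
  have : g^T *m (B *m x) = 0 by rewrite mulmxA gB mul0mx.
  move/matrixP/(_ 0 0); rewrite mxE (bigD1 i) //= big1 => [|c /Bx->]; rewrite ?mulr0 //.
  by rewrite !mxE addr0.
have [u def_x] := exact2 (kerB x Bx0).
case/negP: x_neq0; rewrite def_x; have /matrixP/(_ i 0)/eqP := def_x.
rewrite x_i mxE big_ord1 eq_sym mulf_eq0 (negPf g_i) /= => /eqP u0.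
by apply/eqP/matrixP=> a b; rewrite !mxE big_ord1 !ord1 u0 mulr0.
Qed.

End Pairing.
End LengthThree.

(** * Homogeneous components *)

Section Homogeneous.

Variables (k : fieldType) (r : nat).
Local Notation R := {mpoly k[r]}.
Implicit Types (p q : R).

Lemma pihomogM d e p q :
  q \is e.-homog ->
  pihomog mdeg d (p * q)
    = if (e <= d)%N then pihomog mdeg (d - e) p * q else 0.
Proof.
move=> q_homog; have sizep : (msize p <= msize p + d.+1)%N by rewrite leq_addr.
rewrite {1}(pihomog_partitionE sizep) mulr_suml raddf_sum /=.
have homog_i i : pihomog mdeg i p * q \is (i + e).-homog.
  by apply: dhomogM q_homog; apply: pihomogP.
case: leqP => [le_ed|lt_de].
  have lt_i : (d - e < msize p + d.+1)%N by lia.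
  rewrite (bigD1 (Ordinal lt_i)) //= big1 ?addr0.
    by rewrite pihomog_dE //; have := homog_i (d - e)%N; rewrite subnK.
  move=> i i_neq; apply: pihomog_ne0 (homog_i i).
  by apply: contra i_neq => /eqP d_eq; apply/eqP/val_inj => /=; lia.
by rewrite big1 // => i _; apply: pihomog_ne0 (homog_i i); lia.
Qed.

Lemma dhomog0_const p : p \is 0.-homog -> p = (p@_0%MM)%:MP.
Proof.
move=> p_homog; apply/mpolyP=> m; rewrite mcoeffC.
have [->|m_neq0] := eqVneq m 0%MM; first by rewrite mulr1.
by rewrite mulr0 (dhomog_nemf_coeff p_homog) // mdeg_eq0.
Qed.

Lemma dhomog_prod_const e m (F : 'I_m -> R) :
  (forall i, F i \is e.-homog) -> \prod_i F i \is (m * e).-homog.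
Proof.
elim: m F => [|m IHm] F F_homog; first by rewrite big_ord0 dhomog1.
by rewrite big_ord_recl mulSn dhomogM ?IHm.
Qed.

Lemma det_homog e m (A : 'M[R]_m) :
  (forall i j, A i j \is e.-homog) -> \det A \is (m * e).-homog.
Proof.
move=> A_homog; apply: rpred_sum => s _; rewrite rpredMsign.
exact: dhomog_prod_const.
Qed.

Lemma adjugate_homog e m (A : 'M[R]_m) i j :
  (forall i j, A i j \is e.-homog) -> (\adj A) i j \is (m.-1 * e).-homog.
Proof.
move=> A_homog; rewrite mxE /cofactor rpredMsign.
by apply: det_homog => a b; rewrite !mxE.
Qed.

End Homogeneous.

(** * Pure resolutions of length three *)

Section PureResolution.

Variables (k : fieldType) (r n a b s : nat).
Local Notation R := {mpoly k[r]}.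
Variables (f : 'rV[R]_n) (D : 'M[R]_n) (g : 'cV[R]_n).

Hypothesis f_homog : forall i, f 0 i \is (a).-homog.
Hypothesis D_homog : forall i j, D i j \is (b - a).-homog.
Hypothesis g_homog : forall j, g j 0 \is (s - b).-homog.
Hypothesis D_minimal : minimal_map D.

Hypothesis fD : f *m D = 0.
Hypothesis Dg : D *m g = 0.
Hypothesis exact1 : forall v : 'cV[R]_n, f *m v = 0 -> exists w, v = D *m w.
Hypothesis exact2 : forall w : 'cV[R]_n, D *m w = 0 -> exists u, w = g *m u.
Hypothesis g_inj : forall u : 'cV[R]_1, g *m u = 0 -> u = 0.

(** Both sides of the identity [\adj D = c *: (g *m f)] are homogeneous; these are
    the degrees. *)
Lemma pure_degree :
    (forall p : R, prime_elt p -> ~ forall i, divides p (f 0 i)) ->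
  (n.-1 * (b - a) = s - b + a)%N.
Proof.
move=> f_coprime.
have [c c_unit adjD] := adjugate_middle_map Dg exact1 exact2 g_inj
  (@factorial_mpoly k r) f_coprime.
have [j g_j] := last_map_neq0 g_inj.
have [i f_i] := first_map_neq0 Dg exact1 g_inj.
have /andP[/eqP def_c c0_unit] := c_unit.
have def_adj : (\adj D) j i = c@_0%MM *: (g j 0 * f 0 i).
  by rewrite adjD !mxE big_ord1 def_c mul_mpolyC mcoeffC eqxx mulr1.
apply: (@dhomog_uniq _ _ _ ((\adj D) j i)).
- rewrite def_adj scaler_eq0 negb_or mulf_neq0 // andbT.
  by apply: contraTneq c0_unit => ->; rewrite unitr0.
- exact: adjugate_homog.
- by rewrite def_adj; apply/rpredZ/dhomogM.
Qed.

(** A linear relation with constant coefficients would be a combination of the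
    columns of [D], whose entries have no constant term. *)
Lemma minimal_generators_free (v : 'rV[k]_n) :
  map_mx (@mpolyC r k) v *m f^T = 0 -> v = 0.
Proof.
move=> vf; have [w def_v] : exists w, (map_mx (@mpolyC r k) v)^T = D *m w.
  by apply: exact1; rewrite -[f]trmxK -trmx_mul vf trmx0.
apply/matrixP=> o i; rewrite ord1 mxE.
have /matrixP/(_ i 0)/(congr1 (mcoeff 0%MM)) := def_v.
rewrite !mxE mcoeffC eqxx mulr1 => ->; rewrite raddf_sum big1 // => l _.
by rewrite /= rmorphM /= D_minimal mul0r.
Qed.

(** For [a + b <= s] the product of degree (1,2) has entries of degree
    [a + b - s], so after passing to the component of degree [a] of the Leibniz
    rule it is a constant matrix, zero if [a + b < s]. *)
Lemma constant_pairing : (a + b <= s)%N ->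
  exists (V : 'I_n -> 'M[R]_n) (Q : 'M[k]_n),
    [/\ forall i j l, V i l j = - V j l i, forall i l, V i l i = 0,
        forall i, (f 0 i)%:M - V i *m D = g *m row i (map_mx (@mpolyC r k) Q)
      & (a + b < s)%N -> Q = 0].
Proof.
move=> le_ab_s; have [W [DW W_anti W_diag]] := koszul_homotopy exact1.
have [P leibniz] := leibniz_pairing fD exact2 DW.
(* The component of degree [2 a - b] of [W], the degree of a product of two
   generators, is zero when this number is negative. *)
pose part (p : R) := if (b - a <= a)%N then pihomog mdeg (a - (b - a)) p else 0.
exists (fun i => map_mx part (W i)).
exists (\matrix_(i, l) if s == (a + b)%N then (pihomog mdeg 0 (P i l))@_0%MM
  else 0); split=> [i j l|i l|i|lt_ab_s].
- rewrite !mxE W_anti /part; case: ifP => _; last by rewrite oppr0.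
  exact: raddfN.
- by rewrite mxE W_diag /part; case: ifP => _; rewrite ?raddf0.
- apply/matrixP=> m l; rewrite !mxE big_ord1 !mxE.
  have: f 0 i *+ (m == l) - \sum_t W i m t * D t l = g m 0 * P i l.
    by have /matrixP/(_ m l) := leibniz i; rewrite !mxE big_ord1 !mxE.
  move/(congr1 (pihomog mdeg a)).
  rewrite pihomogB pihomogMn (pihomog_dE (f_homog i)).
  rewrite (raddf_sum (pihomog mdeg a)) => eq_ml.
  have -> : \sum_t map_mx part (W i) m t * D t l
      = \sum_t pihomog mdeg a (W i m t * D t l).
    apply: eq_bigr => t _; rewrite mxE (pihomogM _ _ (D_homog t l)) /part.
    by case: ifP; rewrite ?mul0r.
  rewrite eq_ml mulrC (pihomogM _ _ (g_homog m)) mulrC.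
  case: eqP => [def_s|ne_s].
    have -> : (s - b = a)%N by rewrite def_s addnK.
    by rewrite leqnn subnn [in LHS](dhomog0_const (pihomogP _ _ _)) mulrC.
  case: leqP => [le_sb|_]; first by exfalso; lia.
  by rewrite mpolyC0 mulr0.
by apply/matrixP=> i l; rewrite !mxE gtn_eqF.
Qed.

(** If [det Q = 0], a constant row killing [Q] kills [f^T = Q g], against the linear
    independence of the generators. *)
Lemma pure_pairing : (a + b <= s)%N -> s = (a + b)%N /\ odd n.
Proof.
move=> le_ab_s; have [V [Q [V_anti V_diag leibniz Q0]]] := constant_pairing le_ab_s.
have fE := first_map_pairing Dg g_inj leibniz.
have detQ : \det Q != 0.
  apply/negP=> /det0P[v v_neq0 vQ]; case/eqP: v_neq0.
  by apply: minimal_generators_free; rewrite fE mulmxA -map_mxM vQ map_mx0 mul0mx.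
split; last first.
  apply: (perfect_pairing_odd fD Dg exact2 g_inj V_anti V_diag leibniz).
  by rewrite det_map_mx mpolyC_eq0.
apply/eqP; rewrite eqn_leq le_ab_s andbT leqNgt; apply/negP=> /Q0 Q_eq0.
have [i /eqP[]] := first_map_neq0 Dg exact1 g_inj.
by have /matrixP/(_ i 0) := fE; rewrite Q_eq0 map_mx0 mul0mx !mxE.
Qed.

End PureResolution.

Theorem proposition4p13 (k : fieldType) (n : nat) (a_ b_ : 'I_n -> nat)
    (a b s : nat) :
  (3 <= n)%N ->
  (forall i, (0 < a_ i)%N) -> (forall j, (0 < b_ j)%N) -> (0 < s)%N ->
  (forall i, a_ i = a) -> (forall j, b_ j = b) ->
  essential_Betti_sequence k a_ b_ s ->
  s%:Z = n%:Z * (b%:Z - a%:Z) /\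
  ((n * a < (n - 1) * b)%N /\ ((n - 1) * b <= (n + 1) * a)%N /\
   (~~ odd n -> ((n - 1) * b < (n + 1) * a)%N)).
Proof.
move=> n_ge3 _ _ _ a_E b_E [r [I [_ _ I_ht [f [D [g]]]]]].
case=> -[f_gr D_gr g_gr] [_ D_min g_min] [imf exact1 exact2 g_inj].
have fD : f *m D = 0.
  apply/matrixP=> o j; have : f *m (D *m delta_mx j (0 : 'I_1)) = 0.
    by apply/exact1; exists (delta_mx j 0).
  by rewrite mulmxA -colE => /matrixP/(_ o 0); rewrite !mxE.
have Dg : D *m g = 0 by apply/exact2; exists 1%:M; rewrite mulmx1.
have ex1 (v : 'cV_n) : f *m v = 0 -> exists w, v = D *m w by move/exact1.
have ex2 (w : 'cV_n) : D *m w = 0 -> exists u, w = g *m u by move/exact2.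
have f_homog i : f 0 i \is (a).-homog.
  by have := f_gr 0 i; rewrite /= a_E subn0.
have f_coprime (p : {mpoly k[r]}) :
    prime_elt p -> ~ forall i, divides p (f 0 i).
  move=> p_prime p_f; apply: (height_ge2_coprime (@factorial_mpoly k r) I_ht p_prime).
  move=> x /imf[v /matrixP/(_ 0 0)]; rewrite !mxE eqxx mulr1n => ->.
  by apply: divides_sum => i _; apply: divides_mulr.
have [j g_j] := last_map_neq0 g_inj.
have lt_bs : (b < s)%N.
  have := g_gr j 0; rewrite b_E; case: (leqP b s) => [le_bs g_homog|_ /eqP g0]; last first.
    by rewrite g0 eqxx in g_j.
  rewrite ltn_neqAle le_bs andbT; apply: contraNneq g_j => eq_bs.
  move: g_homog; rewrite eq_bs subnn => /dhomog0_const ->.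
  by rewrite g_min mpolyC0.
(* For [b < a] the matrix [D] is zero and has the truncated degree [b - a = 0]; the
   degree formula then excludes this case. *)
have D_homog i l : D i l \is (b - a).-homog.
  by have := D_gr i l; rewrite a_E b_E; case: leqP => // _ /eqP ->; apply: dhomog0.
have g_homog i : g i 0 \is (s - b).-homog.
  by have := g_gr i 0; rewrite b_E (ltnW lt_bs).
have deg := pure_degree f_homog D_homog g_homog Dg ex1 ex2 g_inj f_coprime.
have pairing := pure_pairing f_homog D_homog g_homog D_min fD Dg ex1 ex2 g_inj.
have le_ab : (a <= b)%N.
  by rewrite leqNgt; apply/negP=> lt_ba; move: deg; have -> : (b - a = 0)%N; lia.
have s_def : s = (n * (b - a))%N by nia.
split; first by rewrite s_def PoszM -subzn.
split; first by nia.
have le_s : (s <= a + b)%N.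
  by rewrite leqNgt; apply/negP=> lt_s; have [] := pairing (ltnW lt_s); lia.
split=> [|even_n]; first by nia.
suff: (s < a + b)%N by nia.
rewrite ltn_neqAle le_s andbT; apply: contraNneq even_n => eq_s.
by case: pairing; rewrite ?eq_s.
Qed.
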